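(* Let $n\ge 2$. Consider the square formed by the natural homomorphisms $B_n\to VB_n$, $B_n\to SB_n$, $VB_n\to SVB_n$ and $SB_n\to SVB_n$, each sending every generator of the source to the generator of the target with the same name. This square is commutative, i.e. the composites $B_n\to VB_n\to SVB_n$ and $B_n\to SB_n\to SVB_n$ are equal, and each of the four homomorphisms is injective.
   Context: Let $n\ge 2$. Consider the following relations, where indices range over $\{1,\dots,n-1\}$ unless otherwise indicated. (R0) $\sigma_i\sigma_j=\sigma_j\sigma_i$ for $|i-j|\ge 2$; (R2) $\sigma_i\sigma_i^{-1}=1=\sigma_i^{-1}\sigma_i$; (R3) $\sigma_i\sigma_{i+1}\sigma_i=\sigma_{i+1}\sigma_i\sigma_{i+1}$ for $i=1,\dots,n-2$; (V1) $\rho_i\rho_j=\rho_j\rho_i$ for $|i-j|\ge 2$; (V2) $\sigma_i\rho_j=\rho_j\sigma_i$ for $|i-j|\ge 2$; (V3) $\rho_i^2=1$; (V4) $\rho_i\rho_{i+1}\rho_i=\rho_{i+1}\rho_i\rho_{i+1}$ for $i=1,\dots,n-2$; (V5) $\rho_i\sigma_{i+1}\rho_i=\rho_{i+1}\sigma_i\rho_{i+1}$ for $i=1,\dots,n-2$; (S1) $\tau_i\tau_j=\tau_j\tau_i$ for $|i-j|\ge 2$; (S2) $\tau_i\sigma_j=\sigma_j\tau_i$ for $|i-j|\ge 2$; (S3) $\tau_i\sigma_i=\sigma_i\tau_i$; (S4) $\sigma_i\sigma_{i+1}\tau_i=\tau_{i+1}\sigma_i\sigma_{i+1}$ for $i=1,\dots,n-2$;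 (SV1) $\rho_i\tau_j=\tau_j\rho_i$ for $|i-j|\ge 2$; (SV2) $\rho_i\tau_{i+1}\rho_i=\rho_{i+1}\tau_i\rho_{i+1}$ for $i=1,\dots,n-2$. The braid group $B_n$ is the group generated by $\sigma_1,\dots,\sigma_{n-1}$ with relations (R0), (R3). The virtual braid group $VB_n$ is the group generated by $\sigma_1,\dots,\sigma_{n-1},\rho_1,\dots,\rho_{n-1}$ with relations (R0), (R3), (V1)-(V5). The singular braid monoid $SB_n$ is the monoid generated by $\sigma_1^{\pm1},\dots,\sigma_{n-1}^{\pm1},\tau_1,\dots,\tau_{n-1}$ with relations (R0), (R2), (R3), (S1)-(S4). The singular virtual braid monoid $SVB_n$ is the monoid generated by $\sigma_1^{\pm1},\dots,\sigma_{n-1}^{\pm1},\rho_1,\dots,\rho_{n-1},\tau_1,\dots,\tau_{n-1}$ with relations (R0), (R2), (R3), (S1)-(S4), (V1)-(V5), (SV1), (SV2). *)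

(* Defs.v *)
From HB Require Import structures.
From mathcomp Require Import all_boot.
From mathcomp Require Import boolp.

Set Implicit Arguments.
Unset Strict Implicit.
Unset Printing Implicit Defensive.

Local Open Scope group_scope.
Local Open Scope quotient_scope.

(******************************************************************************)
(*  pmon R     == the monoid with generators X and relations R : a quotient   *)
(*                of the free monoid seq X by the least congruence above R    *)
(*  pcls R u   == the class of the word u in pmon R                           *)
(*  pgrp R     == the group with generators X and relations R, where R        *)
(*                relates words in the letters (x, false), standing for x,    *)
(*                and (x, true), standing for x^-1                            *)
(*  plift gP   == the monoid morphism pmon R -> M extending g : X -> M, for   *)
(*                gP : respects R g, a proof that g satisfies the relations R *)
(******************************************************************************)

Section MonoidPresentation.

Variables (X : choiceType) (R : seq X -> seq X -> Prop).

Inductive wcong : seq X -> seq X -> Prop :=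
| wcong_rel u v of R u v : wcong u v
| wcong_refl u : wcong u u
| wcong_sym u v of wcong u v : wcong v u
| wcong_trans u v w of wcong u v & wcong v w : wcong u w
| wcong_cat u u' v v' of wcong u u' & wcong v v' : wcong (u ++ v) (u' ++ v').

Definition wcongb (u v : seq X) : bool := `[< wcong u v >].

Lemma wcongb_refl : reflexive wcongb.
Proof. by move=> u; apply/asboolP; apply: wcong_refl. Qed.

Lemma wcongb_sym : symmetric wcongb.
Proof. by move=> u v; apply/asboolP/asboolP => /wcong_sym. Qed.

Lemma wcongb_trans : transitive wcongb.
Proof.
by move=> v u w /asboolP uv /asboolP vw; apply/asboolP; apply: wcong_trans vw.
Qed.

Canonical wcong_equiv := EquivRel wcongb wcongb_refl wcongb_sym wcongb_trans.

Definition pmon := {eq_quot wcong_equiv}.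

HB.instance Definition _ := Choice.on pmon.
HB.instance Definition _ := EqQuotient.on pmon.

Definition pcls (u : seq X) : pmon := \pi_pmon u.

Lemma pclsP u v : pcls u = pcls v <-> wcong u v.
Proof.
split=> [/eqmodP/asboolP // | uv].
by apply/eqmodP/asboolP.
Qed.

Lemma pclsK (c : pmon) : pcls (repr c) = c.
Proof. exact: reprK. Qed.

Definition pmul (c d : pmon) : pmon := pcls (repr c ++ repr d).

Lemma pmulE u v : pmul (pcls u) (pcls v) = pcls (u ++ v).
Proof. by apply/pclsP; apply: wcong_cat; apply/pclsP; rewrite pclsK. Qed.

Lemma pmulA : associative pmul.
Proof.
by move=> a b c; rewrite -(pclsK a) -(pclsK b) -(pclsK c) !pmulE catA.
Qed.

Lemma pmul1 : left_id (pcls [::]) pmul.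
Proof. by move=> a; rewrite -(pclsK a) pmulE. Qed.

Lemma pmulr1 : right_id (pcls [::]) pmul.
Proof. by move=> a; rewrite -(pclsK a) pmulE cats0. Qed.

HB.instance Definition _ := isMonoid.Build pmon pmulA pmul1 pmulr1.

Lemma pclsM u v : pcls u * pcls v = pcls (u ++ v).
Proof. exact: pmulE. Qed.

Lemma pcls_prod u : pcls u = \prod_(x <- u) pcls [:: x].
Proof.
by elim: u => [|x u IHu]; rewrite ?big_nil // big_cons -IHu pclsM.
Qed.

Section Lift.

Variables (M : monoidType) (g : X -> M).

Definition respects : Prop :=
  forall u v, R u v -> \prod_(x <- u) g x = \prod_(x <- v) g x.

Definition plift of respects := fun c : pmon => \prod_(x <- repr c) g x.

Hypothesis gP : respects.

Lemma pliftE u : plift gP (pcls u) = \prod_(x <- u) g x.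
Proof.
have: wcong (repr (pcls u)) u by apply/pclsP; rewrite pclsK.
rewrite /plift; move: (repr _) => w.
elim=> {u w} [u v /gP // | // | u v _ -> // | u v w _ -> _ -> // |].
by move=> u u' v v' _ eu _ ev; rewrite !big_cat /= eu ev.
Qed.

Lemma plift_morphism : monoid_morphism (plift gP).
Proof.
split=> [|c d]; first by rewrite pliftE big_nil.
by rewrite -(pclsK c) -(pclsK d) pclsM !pliftE big_cat.
Qed.

HB.instance Definition _ :=
  isUMagmaMorphism.Build pmon M (plift gP) plift_morphism.

Lemma plift_gen x : plift gP (pcls [:: x]) = g x.
Proof. by rewrite pliftE big_seq1. Qed.

End Lift.

End MonoidPresentation.

Section GroupPresentation.

Variables (X : choiceType) (R : seq (X * bool) -> seq (X * bool) -> Prop).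

Variant grel : seq (X * bool) -> seq (X * bool) -> Prop :=
| grel_rel u v of R u v : grel u v
| grel_mulV x : grel [:: (x, false); (x, true)] [::]
| grel_Vmul x : grel [:: (x, true); (x, false)] [::].

Definition pgrp := pmon grel.

HB.instance Definition _ := Monoid.on pgrp.

Lemma grel_respects (M : monoidType) (g : X * bool -> M) :
    (forall x, g (x, false) * g (x, true) = 1) ->
    (forall x, g (x, true) * g (x, false) = 1) ->
  respects R g -> respects grel g.
Proof.
move=> gV Vg gR _ _ [u v /gR // | x | x].
  by rewrite big_cons big_seq1 big_nil.
by rewrite big_cons big_seq1 big_nil.
Qed.

Definition winv (u : seq (X * bool)) := rev [seq (a.1, ~~ a.2) | a <- u].

Definition pinv (c : pgrp) : pgrp := pcls grel (winv (repr c)).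

Lemma wmulV u : wcong grel (u ++ winv u) [::].
Proof.
elim/last_ind: u => [|u [x b] IHu]; first exact: wcong_refl.
rewrite /winv map_rcons rev_rcons -cats1 -catA /= -/(winv u).
apply: wcong_trans IHu; apply: wcong_cat (wcong_refl _ _) _.
rewrite -[(x, b) :: _]/([:: (x, b); (x, ~~ b)] ++ winv u).
rewrite -[X in wcong _ _ X]/([::] ++ winv u).
apply: wcong_cat (wcong_refl _ _); apply: wcong_rel.
by case: b; constructor.
Qed.

Lemma winvK : involutive winv.
Proof.
move=> u; rewrite /winv map_rev revK -map_comp.
by rewrite map_id_in // => -[x b] _ /=; rewrite negbK.
Qed.

Lemma wVmul u : wcong grel (winv u ++ u) [::].
Proof. by have := wmulV (winv u); rewrite winvK. Qed.

Lemma pmulV : right_inverse 1 pinv (@mul pgrp).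
Proof.
move=> c; rewrite -[c in LHS]pclsK [LHS]pclsM; apply/pclsP.
by rewrite pclsK; apply: wmulV.
Qed.

Lemma pVmul : left_inverse 1 pinv (@mul pgrp).
Proof.
move=> c; rewrite -[c in X in _ * X]pclsK [LHS]pclsM; apply/pclsP.
exact: wVmul.
Qed.

HB.instance Definition _ := hasInv.Build pgrp pinv.
HB.instance Definition _ := Monoid_isGroup.Build pgrp pVmul pmulV.

Lemma pgrp_invE x :
  (pcls grel [:: (x, false)] : pgrp)^-1 = pcls grel [:: (x, true)].
Proof.
apply: mulg1_eq; rewrite [LHS]pclsM; apply/pclsP/wcong_rel.
exact: grel_mulV.
Qed.

End GroupPresentation.

(* The indices 1, ..., n-1 of the generators are encoded by 'I_n.-1, so they  *)
(* are shifted to 0, ..., n-2.                                                *)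

Definition far m (i j : 'I_m) : bool := (i.+1 < j) || (j.+1 < i).

Definition adj m (i j : 'I_m) : bool := j == i.+1 :> nat.

Section Generators.

Variable m : nat.

Variant vgen := VSig of 'I_m | VRho of 'I_m.

Variant sgen := SSig of 'I_m | SSigV of 'I_m | STau of 'I_m.

Variant svgen :=
  | SVSig of 'I_m | SVSigV of 'I_m | SVRho of 'I_m | SVTau of 'I_m.

Definition vgen_code g := match g with VSig i => inl i | VRho i => inr i end.
Definition vgen_decode c := match c with inl i => VSig i | inr i => VRho i end.
Lemma vgen_codeK : cancel vgen_code vgen_decode. Proof. by case. Qed.
HB.instance Definition _ := Finite.copy vgen (can_type vgen_codeK).

Definition sgen_code g :=
  match g with
  | SSig i => inl (inl i) | SSigV i => inl (inr i) | STau i => inr i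
  end.
Definition sgen_decode c :=
  match c with
  | inl (inl i) => SSig i | inl (inr i) => SSigV i | inr i => STau i
  end.
Lemma sgen_codeK : cancel sgen_code sgen_decode. Proof. by case. Qed.
HB.instance Definition _ := Finite.copy sgen (can_type sgen_codeK).

Definition svgen_code g :=
  match g with
  | SVSig i => inl (inl i) | SVSigV i => inl (inr i)
  | SVRho i => inr (inl i) | SVTau i => inr (inr i)
  end.
Definition svgen_decode c :=
  match c with
  | inl (inl i) => SVSig i | inl (inr i) => SVSigV i
  | inr (inl i) => SVRho i | inr (inr i) => SVTau i
  end.
Lemma svgen_codeK : cancel svgen_code svgen_decode. Proof. by case. Qed.
HB.instance Definition _ := Finite.copy svgen (can_type svgen_codeK).

End Generators.

Section Relations.

Variable m : nat.
Implicit Types i j : 'I_m.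

Section Braid.

Local Notation s i := (i, false) (only parsing).

Variant B_rel : seq ('I_m * bool) -> seq ('I_m * bool) -> Prop :=
| B_R0 i j of far i j : B_rel [:: s i; s j] [:: s j; s i]
| B_R3 i j of adj i j : B_rel [:: s i; s j; s i] [:: s j; s i; s j].

End Braid.

Section VirtualBraid.

Local Notation s i := (VSig i, false) (only parsing).
Local Notation r i := (VRho i, false) (only parsing).

Variant VB_rel : seq (vgen m * bool) -> seq (vgen m * bool) -> Prop :=
| VB_R0 i j of far i j : VB_rel [:: s i; s j] [:: s j; s i]
| VB_R3 i j of adj i j : VB_rel [:: s i; s j; s i] [:: s j; s i; s j]
| VB_V1 i j of far i j : VB_rel [:: r i; r j] [:: r j; r i]
| VB_V2 i j of far i j : VB_rel [:: s i; r j] [:: r j; s i]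
| VB_V3 i : VB_rel [:: r i; r i] [::]
| VB_V4 i j of adj i j : VB_rel [:: r i; r j; r i] [:: r j; r i; r j]
| VB_V5 i j of adj i j : VB_rel [:: r i; s j; r i] [:: r j; s i; r j].

End VirtualBraid.

Section SingularBraid.

Local Notation s i := (SSig i) (only parsing).
Local Notation s' i := (SSigV i) (only parsing).
Local Notation t i := (STau i) (only parsing).

Variant SB_rel : seq (sgen m) -> seq (sgen m) -> Prop :=
| SB_R0 i j of far i j : SB_rel [:: s i; s j] [:: s j; s i]
| SB_R2r i : SB_rel [:: s i; s' i] [::]
| SB_R2l i : SB_rel [:: s' i; s i] [::]
| SB_R3 i j of adj i j : SB_rel [:: s i; s j; s i] [:: s j; s i; s j]
| SB_S1 i j of far i j : SB_rel [:: t i; t j] [:: t j; t i]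
| SB_S2 i j of far i j : SB_rel [:: t i; s j] [:: s j; t i]
| SB_S3 i : SB_rel [:: t i; s i] [:: s i; t i]
| SB_S4 i j of adj i j : SB_rel [:: s i; s j; t i] [:: t j; s i; s j].

End SingularBraid.

Section SingularVirtualBraid.

Local Notation s i := (SVSig i) (only parsing).
Local Notation s' i := (SVSigV i) (only parsing).
Local Notation r i := (SVRho i) (only parsing).
Local Notation t i := (SVTau i) (only parsing).

Variant SVB_rel : seq (svgen m) -> seq (svgen m) -> Prop :=
| SVB_R0 i j of far i j : SVB_rel [:: s i; s j] [:: s j; s i]
| SVB_R2r i : SVB_rel [:: s i; s' i] [::]
| SVB_R2l i : SVB_rel [:: s' i; s i] [::]
| SVB_R3 i j of adj i j : SVB_rel [:: s i; s j; s i] [:: s j; s i; s j]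
| SVB_S1 i j of far i j : SVB_rel [:: t i; t j] [:: t j; t i]
| SVB_S2 i j of far i j : SVB_rel [:: t i; s j] [:: s j; t i]
| SVB_S3 i : SVB_rel [:: t i; s i] [:: s i; t i]
| SVB_S4 i j of adj i j : SVB_rel [:: s i; s j; t i] [:: t j; s i; s j]
| SVB_V1 i j of far i j : SVB_rel [:: r i; r j] [:: r j; r i]
| SVB_V2 i j of far i j : SVB_rel [:: s i; r j] [:: r j; s i]
| SVB_V3 i : SVB_rel [:: r i; r i] [::]
| SVB_V4 i j of adj i j : SVB_rel [:: r i; r j; r i] [:: r j; r i; r j]
| SVB_V5 i j of adj i j : SVB_rel [:: r i; s j; r i] [:: r j; s i; r j]
| SVB_SV1 i j of far i j : SVB_rel [:: r i; t j] [:: t j; r i]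
| SVB_SV2 i j of adj i j : SVB_rel [:: r i; t j; r i] [:: r j; t i; r j].

End SingularVirtualBraid.

End Relations.

Definition B n : groupType := pgrp (@B_rel n.-1).
Definition VB n : groupType := pgrp (@VB_rel n.-1).
Definition SB n : monoidType := pmon (@SB_rel n.-1).
Definition SVB n : monoidType := pmon (@SVB_rel n.-1).

Section Morphisms.

Variable n : nat.
Implicit Types i : 'I_n.-1.

Definition B_sigma i : B n := pcls _ [:: (i, false)].
Definition VB_sigma i : VB n := pcls _ [:: (VSig i, false)].
Definition VB_rho i : VB n := pcls _ [:: (VRho i, false)].
Definition SB_sigma i : SB n := pcls _ [:: SSig i].
Definition SB_sigmaV i : SB n := pcls _ [:: SSigV i].
Definition SB_tau i : SB n := pcls _ [:: STau i].
Definition SVB_sigma i : SVB n := pcls _ [:: SVSig i].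
Definition SVB_sigmaV i : SVB n := pcls _ [:: SVSigV i].
Definition SVB_rho i : SVB n := pcls _ [:: SVRho i].
Definition SVB_tau i : SVB n := pcls _ [:: SVTau i].

Definition B_VB_gen (a : 'I_n.-1 * bool) : VB n :=
  if a.2 then (VB_sigma a.1)^-1 else VB_sigma a.1.

Definition B_SB_gen (a : 'I_n.-1 * bool) : SB n :=
  if a.2 then SB_sigmaV a.1 else SB_sigma a.1.

(* Each rho_i is its own inverse, so the letter rho_i^-1 of a group word is   *)
(* also sent to the generator rho_i of the monoid SVB n.                      *)
Definition VB_SVB_gen (a : vgen n.-1 * bool) : SVB n :=
  match a with
  | (VSig i, false) => SVB_sigma i
  | (VSig i, true) => SVB_sigmaV i
  | (VRho i, _) => SVB_rho i
  end.

Definition SB_SVB_gen (a : sgen n.-1) : SVB n :=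
  match a with
  | SSig i => SVB_sigma i
  | SSigV i => SVB_sigmaV i
  | STau i => SVB_tau i
  end.

Lemma B_VB_respects : respects (grel (@B_rel n.-1)) B_VB_gen.
Proof.
apply: grel_respects => [i|i|]; [exact: mulgV | exact: mulVg |].
have E u : all (fun a => ~~ a.2) u ->
    \prod_(a <- u) B_VB_gen a = pcls _ [seq (VSig a.1, a.2) | a <- u] :> VB n.
  move=> u0; rewrite [RHS]pcls_prod big_map !big_seq.
  by apply: eq_bigr => -[i []] // /(allP u0).
by move=> _ _ [] *; rewrite !E //; apply/pclsP/wcong_rel/grel_rel; constructor.
Qed.

Lemma B_SB_respects : respects (grel (@B_rel n.-1)) B_SB_gen.
Proof.
have E u : \prod_(a <- u) B_SB_gen a
    = pcls _ [seq (if a.2 then SSigV a.1 else SSig a.1) | a <- u] :> SB n.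
  by rewrite [RHS]pcls_prod big_map; apply: eq_bigr => -[i []].
apply: grel_respects => [i|i|_ _ [] *]; last 2 first.
- by rewrite !E; apply/pclsP/wcong_rel; constructor.
- by rewrite !E; apply/pclsP/wcong_rel; constructor.
- by rewrite [LHS]pclsM; apply/pclsP/wcong_rel; constructor.
- by rewrite [LHS]pclsM; apply/pclsP/wcong_rel; constructor.
Qed.

Lemma VB_SVB_respects : respects (grel (@VB_rel n.-1)) VB_SVB_gen.
Proof.
have E u : \prod_(a <- u) VB_SVB_gen a
    = pcls _ [seq match a with
                  | (VSig i, false) => SVSig i
                  | (VSig i, true) => SVSigV i
                  | (VRho i, _) => SVRho i
                  end | a <- u] :> SVB n.
  by rewrite [RHS]pcls_prod big_map; apply: eq_bigr => -[[i|i] []].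
apply: grel_respects => [[i|i]|[i|i]|_ _ [] *].
1-4: by rewrite [LHS]pclsM; apply/pclsP/wcong_rel; constructor.
all: by rewrite !E; apply/pclsP/wcong_rel; constructor.
Qed.

Lemma SB_SVB_respects : respects (@SB_rel n.-1) SB_SVB_gen.
Proof.
have E u : \prod_(a <- u) SB_SVB_gen a
    = pcls _ [seq match a with
                  | SSig i => SVSig i | SSigV i => SVSigV i | STau i => SVTau i
                  end | a <- u] :> SVB n.
  by rewrite [RHS]pcls_prod big_map; apply: eq_bigr => -[].
by move=> _ _ [] *; rewrite !E; apply/pclsP/wcong_rel; constructor.
Qed.

Definition B_VB : UMagmaMorphism.type (B n) (VB n) :=
  plift B_VB_respects.
Definition B_SB : UMagmaMorphism.type (B n) (SB n) :=
  plift B_SB_respects.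
Definition VB_SVB : UMagmaMorphism.type (VB n) (SVB n) :=
  plift VB_SVB_respects.
Definition SB_SVB : UMagmaMorphism.type (SB n) (SVB n) :=
  plift SB_SVB_respects.

Lemma B_VB_sigma i : B_VB (B_sigma i) = VB_sigma i.
Proof. exact: plift_gen. Qed.

Lemma B_SB_sigma i : B_SB (B_sigma i) = SB_sigma i.
Proof. exact: plift_gen. Qed.

Lemma B_SB_sigmaV i : B_SB (B_sigma i)^-1 = SB_sigmaV i.
Proof. by rewrite pgrp_invE; apply: plift_gen. Qed.

Lemma VB_SVB_sigma i : VB_SVB (VB_sigma i) = SVB_sigma i.
Proof. exact: plift_gen. Qed.

Lemma VB_SVB_sigmaV i : VB_SVB (VB_sigma i)^-1 = SVB_sigmaV i.
Proof. by rewrite pgrp_invE; apply: plift_gen. Qed.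

Lemma VB_SVB_rho i : VB_SVB (VB_rho i) = SVB_rho i.
Proof. exact: plift_gen. Qed.

Lemma SB_SVB_sigma i : SB_SVB (SB_sigma i) = SVB_sigma i.
Proof. exact: plift_gen. Qed.

Lemma SB_SVB_sigmaV i : SB_SVB (SB_sigmaV i) = SVB_sigmaV i.
Proof. exact: plift_gen. Qed.

Lemma SB_SVB_tau i : SB_SVB (SB_tau i) = SVB_tau i.
Proof. exact: plift_gen. Qed.

End Morphisms.

(* Main.v *)
Require Import Defs.
From mathcomp Require Import all_boot.
From mathcomp Require Import all_order all_algebra all_fingroup.
From mathcomp Require Import boolp zify ring.

Set Implicit Arguments.
Unset Strict Implicit.
Unset Printing Implicit Defensive.

Import Order.TTheory GRing.Theory Num.Theory.

(** Erasing the singular generators tau_i retracts SB_n onto B_n and SVB_n onto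
    VB_n, so B_n -> SB_n and VB_n -> SVB_n are injective.  The square commutes
    on generators; hence, once SB_n -> SVB_n is known to be injective, so is the
    composite B_n -> SVB_n, and with it B_n -> VB_n.

    What remains is SB_n -> SVB_n.  It has a left inverse, a map of sets that is
    not a morphism.  Conjugating sigma_i and tau_i by permutations of the rho_j
    gives crossings sigma_(p,q) and tau_(p,q) for all ordered pairs of distinct
    positions, with braid-like relations for pairs (p,q), (q,r), commutations
    for disjoint pairs and no relation otherwise.  So the sigma_(p,q) generate
    an Artin group, in which the pairs (a,a+1) form the set of generators X of a
    parabolic subgroup, the braid group.  An Artin group retracts onto such a
    subgroup as follows.  Read a word from left to right and remember the coset
    W_X w of the prefix in the Coxeter group W, with w its shortest
    representative; replace a letter s by w s w^-1 if this is in X, and erase it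
    otherwise.  The same rule makes sense for singular letters, and a letter
    rho only permutes the positions; the resulting map on words is [run].

    The rule respects the defining relations ([run_rel]).  A relation involves
    at most two of the crossings, and can be followed on the roots w^-1 e_a for
    a in X.  Two facts about them are needed.  First, they stay nonnegative:
    this comes from the theorem that every root of a Coxeter group is
    nonnegative or nonpositive ([root_signed], [refl_nonneg]), proved by the
    usual reduction to dihedral groups.  Secondly, when two letters at (p,q) and
    (q,r) are both kept, their labels are a and a+1 in this order; the opposite
    order would be fatal, because the relation
    sigma_i sigma_(i+1) tau_i = tau_(i+1) sigma_i sigma_(i+1) is imposed in one
    orientation only.  This follows from a linear map sending the simple root
    (p,q) to eps_p - eps_q, which is equivariant modulo 3 for the map from W to
    the symmetric group ([boundary_refl]). *)

(** * Positivity of roots *)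

Section RootSystem.

Local Open Scope ring_scope.

Variables (I : finType) (B : I -> I -> int).

Local Notation V := {ffun I -> int}.

Definition simple_root (i : I) : V := [ffun k => (k == i)%:R].

(** The form [B] extended by linearity: the coordinates of a vector refer to the
    simple roots. *)
Definition pairing (y : V) (i : I) : int := \sum_k y k * B k i.

Definition refl (i : I) (y : V) : V :=
  [ffun k => y k - (k == i)%:R * pairing y i].

Definition act (u : seq I) (y : V) : V := foldr refl y u.

Definition nonneg (y : V) : Prop := forall k, 0 <= y k.

Definition nonpos (y : V) : Prop := forall k, y k <= 0.

Inductive real_root : V -> Prop :=
| real_root_simple i : real_root (simple_root i)
| real_root_refl i y of real_root y : real_root (refl i y).

Lemma pairing_simple i k : pairing (simple_root i) k = B i k.
Proof.
rewrite /pairing (bigD1 i) //= ffunE eqxx mul1r big1 ?addr0 // => j /negPf ji.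
by rewrite ffunE ji mul0r.
Qed.

Lemma pairing_refl i y k :
  pairing (refl i y) k = pairing y k - pairing y i * B i k.
Proof.
rewrite -(pairing_simple i k); set c := pairing y i.
rewrite /pairing mulr_sumr -sumrB; apply: eq_bigr => j _.
by rewrite !ffunE -/c; ring.
Qed.

(** The values 0, -1 and -2 off the diagonal mean that the product of the two
    reflections has order 2, 3 and infinity respectively. *)
Hypothesis B_diag : forall i, B i i = 2.
Hypothesis B_sym : forall i k, B i k = B k i.
Hypothesis B_off : forall i k, i != k -> B i k \in [:: 0; -1; -2].

Lemma reflK i : involutive (refl i).
Proof.
move=> y; apply/ffunP => k; rewrite [LHS]ffunE pairing_refl B_diag !ffunE.
by case: (k == i); ring.
Qed.

Lemma refl_simple i : refl i (simple_root i) = [ffun k => - (simple_root i k)].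
Proof. by apply/ffunP => k; rewrite !ffunE pairing_simple B_diag; ring. Qed.

Lemma refl_comm i k y : B i k = 0 -> refl i (refl k y) = refl k (refl i y).
Proof.
move=> ik; have ki : B k i = 0 by rewrite B_sym.
by apply/ffunP => j; rewrite !ffunE !pairing_refl ik ki; ring.
Qed.

Lemma refl_braid i k y : B i k = -1 ->
  refl i (refl k (refl i y)) = refl k (refl i (refl k y)).
Proof.
move=> ik; have ki : B k i = -1 by rewrite B_sym.
apply/ffunP => j; rewrite !ffunE !pairing_refl ik ki !B_diag; ring.
Qed.

Lemma refl_lin i (a b : int) (y z x : V) :
    (forall k, x k = a * y k + b * z k) ->
  forall k, refl i x k = a * refl i y k + b * refl i z k.
Proof.
move=> xE k; rewrite !ffunE xE.
have -> : pairing x i = a * pairing y i + b * pairing z i.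
  rewrite /pairing !mulr_sumr -big_split; apply: eq_bigr => j _ /=.
  by rewrite xE; ring.
by ring.
Qed.

Lemma act_lin u (a b : int) (y z x : V) :
    (forall k, x k = a * y k + b * z k) ->
  forall k, act u x k = a * act u y k + b * act u z k.
Proof. by move=> xE; elim: u => //= i u IHu; apply: refl_lin. Qed.

Lemma act_cat u v y : act (u ++ v) y = act u (act v y).
Proof. exact: foldr_cat. Qed.

Lemma root_act y : real_root y -> exists u i, y = act u (simple_root i).
Proof.
elim=> [i | i _ _ [u [k ->]]]; first by exists [::], i.
by exists (i :: u), k.
Qed.

(** The alternating word of length k in r and i that ends with r: up to the
    choice of the last letter, these are the only reduced words in two
    reflections. *)
Fixpoint alt_word (r i : I) (k : nat) : seq I :=
  if k is k'.+1 then (if odd k' then i else r) :: alt_word r i k' else [::].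

(** Inside the dihedral group of r and i, a shortest word d that does not get
    shorter when multiplied by i on the right alternates and ends with r;
    when the product of the reflections has finite order 2 or 3, the
    commutation or braid relation bounds its length. *)
Lemma reduced_alt_word r i d :
    r != i -> all (mem [:: r; i]) d ->
    (forall d', all (mem [:: r; i]) d' -> act d' =1 act d ->
       (size d <= size d')%N) ->
    (forall d', all (mem [:: r; i]) d' -> act d' =1 act (d ++ [:: i]) ->
       (size d <= size d')%N) ->
  [/\ d = alt_word r i (size d), B r i = 0 -> (size d <= 1)%N
    & B r i = -1 -> (size d <= 2)%N].
Proof.
move=> ri; elim: d => // x d IHd /= /andP[xri dri] redd longd.
have [|d' d'ri d'E|d' d'ri d'E|dE d2 d3] := IHd _.
- by [].
- have := redd (x :: d'); rewrite /= xri => /(_ d'ri); rewrite ltnS; apply.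
  by move=> y /=; rewrite d'E.
- have := longd (x :: d'); rewrite /= xri => /(_ d'ri); rewrite ltnS; apply.
  by move=> y /=; rewrite d'E.
have rI : r \in [:: r; i] by rewrite !inE eqxx.
have iI : i \in [:: r; i] by rewrite !inE eqxx orbT.
have xE : x = if odd (size d) then i else r.
  case: d dE {IHd d2 d3} redd longd dri => [|z d] dE redd longd /=.
    move: xri; rewrite !inE => /orP[/eqP // | /eqP xi].
    have := longd [::] isT; rewrite xi /= => /(_ _) H; exfalso.
    suff: (1 <= 0)%N by []. 
    by apply: H => y /=; rewrite reflK.
  case/andP=> zri dri.
  have xz : x != z.
    apply/eqP => xz; have := redd d dri; rewrite xz /= => H.
    suff: ((size d).+2 <= size d)%N by lia.
    by apply: H => y /=; rewrite reflK.
  move: dE => [zE _]; move: xz xri; rewrite zE !inE /=.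
  by case: (odd (size d)) => /= /negPf ->; rewrite ?orbF ?orbT => /eqP.
split; first by rewrite xE -dE.
- move=> B0; move: (d2 B0).
  case: d dE xE {IHd d2 d3 dri redd} longd => [|z [|//]] //= [->] -> longd _.
  have /= := longd [:: r]; rewrite inE eqxx /= => H; suff : (2 <= 1)%N by [].
  by apply: H => // y /=; rewrite refl_comm ?reflK // B_sym.
- move=> B1; move: (d3 B1).
  case: d dE xE {IHd d2 d3 dri redd} longd => [|z [|z' [|//]]] //=.
  move=> [->] -> -> longd _.
  have /= := longd [:: i; r]; rewrite !inE !eqxx orbT /= => H.
  suff : (3 <= 2)%N by [].
  by apply: H => // y /=; rewrite refl_braid // reflK.
Qed.

(** The positivity theorem for dihedral groups.  In the infinite case the
    coefficients are consecutive integers, which grow with the word. *)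
Lemma act_alt_word r i k : r != i ->
    (B r i = 0 -> (k <= 1)%N) -> (B r i = -1 -> (k <= 2)%N) ->
  exists a b, [/\ 0 <= a, 0 <= b & forall j,
    act (alt_word r i k) (simple_root i) j
      = a * simple_root r j + b * simple_root i j].
Proof.
move=> ri k1 k2; have ir : i != r by rewrite eq_sym.
pose C a b : V := [ffun j => a * simple_root r j + b * simple_root i j].
have reflr a b : refl r (C a b) = C (- a - B r i * b) b.
  apply/ffunP => j.
  rewrite [LHS](@refl_lin r a b (simple_root r) (simple_root i)); last first.
    by move=> l; rewrite ffunE.
  by rewrite !ffunE !pairing_simple B_diag (B_sym i r); ring.
have refli a b : refl i (C a b) = C a (- b - B r i * a).
  apply/ffunP => j.
  rewrite [LHS](@refl_lin i a b (simple_root r) (simple_root i)); last first.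
    by move=> l; rewrite ffunE.
  by rewrite !ffunE !pairing_simple B_diag; ring.
have C0 : simple_root i = C 0 1 by apply/ffunP=> j; rewrite !ffunE; ring.
suff [a [b [a0 b0 abE]]] : exists a b, [/\ 0 <= a, 0 <= b
    & act (alt_word r i k) (simple_root i) = C a b].
  by exists a, b; split=> // j; rewrite abE ffunE.
have := B_off ri; rewrite !inE => /or3P[] /eqP Bri.
- case: k {k2} k1 => [|[|k]] k1; last by have := k1 Bri.
    by exists 0, 1.
  by exists 0, 1; rewrite /= C0 reflr Bri; split=> //; congr C; ring.
- case: k {k1} k2 => [|[|[|k]]] k2; last by have := k2 Bri.
  + by exists 0, 1.
  + by exists 1, 1; rewrite /= C0 reflr Bri; split=> //; congr C; ring.
  + by exists 1, 0; rewrite /= C0 reflr refli Bri; split=> //; congr C; ring.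
- exists (if odd k then k.+1%:Z else k%:Z), (if odd k then k%:Z else k.+1%:Z).
  split; [by case: odd | by case: odd |].
  elim: k {k1 k2} => [|k IHk]; first by rewrite C0.
  rewrite /= IHk; case: (odd k) => /=; rewrite ?reflr ?refli Bri; congr C; lia.
Qed.

(** The key step towards the positivity of roots: if multiplying by i on the
    right does not shorten the group element u, then u sends the simple root i
    to a nonnegative vector.  By induction on the length: let r be the last
    letter of u and write u = v d with d in the dihedral group of r and i, the
    lengths adding up, and v as short as possible.  Neither r nor i shortens v,
    so v sends both simple roots to nonnegative vectors, and d sends the simple
    root i to a nonnegative combination of these two. *)
Lemma length_pos u i :
    (forall u', act u' =1 act u -> (size u <= size u')%N) ->
    (forall u', act u' =1 act (u ++ [:: i]) -> (size u <= size u')%N) ->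
  nonneg (act u (simple_root i)).
Proof.
have [n] := ubnP (size u); elim: n u i => // n IHn u i.
rewrite ltnS => un redu longu.
case/lastP: u un redu longu => [_ _ _ j|u r]; first by rewrite ffunE; case: eqP.
rewrite size_rcons -cats1 => un redu longu.
have ri : r != i.
  apply/eqP => ri; have := longu u => H; suff : (size u < size u)%N by lia.
  by apply: H => y; rewrite !act_cat /= ri reflK.
(* The possible lengths of v in a factorization u = v d of minimal length. *)
pose split_at k := `[< exists v d, [/\ size v = k, all (mem [:: r; i]) d,
  act (v ++ d) =1 act (u ++ [:: r]) & (size v + size d)%N = (size u).+1] >].
have exk : exists k, split_at k.
  exists (size u); apply/asboolP; exists u, [:: r]; split=> //.
    by rewrite /= !inE eqxx.
  by rewrite addn1.
case: (ex_minnP exk) => k /asboolP[v [d [vk dri vdE szvd]]] mink.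
have uk : (k <= size u)%N.
  apply: mink; apply/asboolP; exists u, [:: r].
  split=> //; last by rewrite addn1.
  by rewrite /= !inE eqxx.
have redv v' : act v' =1 act v -> (size v <= size v')%N.
  move=> v'E; have := redu (v' ++ d); rewrite -szvd size_cat leq_add2r.
  by apply=> y; rewrite -vdE !act_cat v'E.
have longv x v' : x \in [:: r; i] -> act v' =1 act (v ++ [:: x]) ->
    (size v <= size v')%N.
  move=> xI v'E; rewrite leqNgt; apply/negP => ltv.
  have v'dE : act (v' ++ x :: d) =1 act (u ++ [:: r]).
    by move=> y; rewrite -vdE !act_cat v'E act_cat /= reflK.
  have := redu _ v'dE; rewrite size_cat /= => le1.
  have /mink : split_at (size v'); last by lia.
  apply/asboolP; exists v', (x :: d); split=> //=.
    by move: xI dri; rewrite !inE => ->.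
  move: ltv szvd le1; clear.
  by move: (size v) (size v') (size d) (size u) => a b c e; lia.
have posv x : x \in [:: r; i] -> nonneg (act v (simple_root x)).
  move=> xI; apply: (IHn v x) => //; first by rewrite vk (leq_ltn_trans uk).
  by move=> v'; apply: longv.
have [d' d'I d'E|d' d'I d'E|dE d2 d3] := @reduced_alt_word r i d ri dri.
- have := redu (v ++ d'); rewrite -szvd size_cat leq_add2l; apply=> y.
  by rewrite -vdE !act_cat d'E.
- have := longu (v ++ d'); rewrite -szvd size_cat leq_add2l; apply=> y.
  by rewrite [LHS]act_cat d'E [RHS]act_cat -vdE !act_cat.
have [a [b [a0 b0 dabE]]] := act_alt_word ri d2 d3.
move=> j; rewrite -vdE act_cat dE (act_lin v dabE).
by rewrite addr_ge0 // mulr_ge0 // posv // !inE eqxx ?orbT.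
Qed.

(** Compare the lengths of u and u i: [length_pos] applies to the shorter of the
    two, and i changes the sign of its own simple root. *)
Lemma root_signed y : real_root y -> nonneg y \/ nonpos y.
Proof.
case/root_act=> u [i ->].
have minword v : exists2 w, act w =1 act v &
    forall w', act w' =1 act v -> (size w <= size w')%N.
  have exk : exists k, `[< exists2 w, act w =1 act v & size w = k >].
    by exists (size v); apply/asboolP; exists v.
  case: (ex_minnP exk) => k /asboolP[w wE wk] mink; exists w => // w' w'E.
  by rewrite wk mink //; apply/asboolP; exists w'.
have [v vE minv] := minword u; have [w wE minw] := minword (u ++ [:: i]).
have [lew|ltw] := leqP (size v) (size w).
  left; rewrite -vE; apply: length_pos => v' v'E.
    by rewrite minv // => z; rewrite v'E vE.
  by apply: leq_trans lew (minw _ _) => z; rewrite v'E !act_cat vE.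
right=> j; have: nonneg (act w (simple_root i)).
  apply: length_pos => v' v'E; first by rewrite minw // => z; rewrite v'E wE.
  apply: leq_trans (ltnW ltw) (minv _ _) => z.
  by rewrite v'E !act_cat wE act_cat /= reflK.
move/(_ j); rewrite wE act_cat /= refl_simple.
rewrite (@act_lin u (-1) 0 (simple_root i) (simple_root i)); last first.
  by move=> k; rewrite ffunE; ring.
by lia.
Qed.

(** Reflections are invertible over the integers, so a common divisor of the
    coordinates survives along the orbit, down to a simple root. *)
Lemma root_primitive y (d : int) :
  real_root y -> (forall k, (d %| y k)%Z) -> (d %| 1)%Z.
Proof.
elim=> [i /(_ i)|i {}y _ IHy dvdy]; first by rewrite ffunE eqxx.
apply: IHy => k; rewrite -(reflK i y) ffunE rpredB ?dvdy //.
by rewrite dvdz_mull // rpred_sum // => j _; rewrite dvdz_mulr.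
Qed.

(** A reflection changes one coordinate only; if the image of a nonnegative root
    is not nonnegative, then it is nonpositive, so the root is a multiple of
    the simple root i, hence equal to it by primitivity. *)
Lemma refl_nonneg i y :
  real_root y -> nonneg y -> y != simple_root i -> nonneg (refl i y).
Proof.
move=> rooty posy yi.
have [//|negy] := root_signed (real_root_refl i rooty).
have y0 k : k != i -> y k = 0.
  move=> /negPf ki; apply/eqP; rewrite eq_le posy andbT.
  by have := negy k; rewrite ffunE ki mul0r subr0.
case/eqP: yi; apply/ffunP => k; rewrite ffunE.
have [->|/y0 //] := eqVneq k i.
have := @root_primitive y (y i) rooty; have := posy i; move: y0.
move=> y0 posi /(_ _); rewrite dvdz1 => H.
suff : `|y i|%N == 1%N by move: posi; case: (y i) => // l _ /eqP /= ->.
by apply: H => j; have [->//|/y0 ->] := eqVneq j i; rewrite dvdz0.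
Qed.

End RootSystem.

(** * The Coxeter form on ordered pairs *)

Section PairForm.

Local Open Scope ring_scope.

Variable P : finType.
Implicit Types k l : P * P.

(** The scalar product of eps_(k.1) - eps_(k.2) and eps_(l.1) - eps_(l.2). *)
Definition dipole_form k l : int :=
  (k.1 == l.1)%:R - (k.1 == l.2)%:R - (k.2 == l.1)%:R + (k.2 == l.2)%:R.

(** The Coxeter form of the group generated by reflections indexed by ordered
    pairs, with order 3 for consecutive pairs (p, q) and (q, r), order 2 for
    disjoint pairs and infinite order otherwise.  The value -2 at infinite
    order is chosen so that the form agrees modulo 3 with [dipole_form], which
    takes there the values 1 and -2.  The pairs (p, p), present only because the
    index set is a full product, are orthogonal to all the others. *)
Definition pair_form k l : int :=
  if k == l then 2 else if dipole_form k l == 1 then -2 else dipole_form k l.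

Local Notation V := {ffun P * P -> int}.
Local Notation B := pair_form.
Local Notation e := (@simple_root (P * P)%type).

Lemma pair_form_diag k : B k k = 2.
Proof. by rewrite /B eqxx. Qed.

Lemma pair_form_sym k l : B k l = B l k.
Proof.
rewrite /B eq_sym; suff -> : dipole_form k l = dipole_form l k by [].
rewrite /dipole_form ![l.1 == _]eq_sym ![l.2 == _]eq_sym; ring.
Qed.

Lemma pair_form_off k l : k != l -> B k l \in [:: 0; -1; -2].
Proof.
rewrite /B => kl; rewrite (negPf kl); move: kl.
rewrite -pair_eqE /= /pair_eq /dipole_form /=.
by do 4 case: (@eqP P _ _) => _.
Qed.

Lemma pair_form_disjoint k l :
  k.1 != l.1 -> k.1 != l.2 -> k.2 != l.1 -> k.2 != l.2 -> B k l = 0.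
Proof.
rewrite /B -pair_eqE /= /pair_eq /dipole_form => /negPf -> /negPf ->.
by move=> /negPf -> /negPf ->.
Qed.

Lemma pair_form_path p q r : p != q -> q != r -> p != r -> B (p, q) (q, r) = -1.
Proof.
rewrite /B -pair_eqE /= /pair_eq /dipole_form /= => /negPf -> /negPf ->.
by move=> /negPf ->; rewrite eqxx.
Qed.

Lemma pair_form_mod3 k l : l.1 != l.2 ->
  (B k l)%:~R = (k.1 == l.1)%:R - (k.2 == l.1)%:R
                - ((k.1 == l.2)%:R - (k.2 == l.2)%:R) :> 'F_3.
Proof.
move=> l12; rewrite /B; have [->|_] := eqVneq k l.
  by rewrite !eqxx (negPf l12) eq_sym (negPf l12); apply/eqP.
by rewrite /dipole_form; do 4 case: (@eqP P _ _) => _; apply/eqP.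
Qed.

(** The linear map sending the simple root (p, q) to eps_p - eps_q.  It is taken
    modulo 3 because it is then equivariant: the reflection at (p, q) acts on
    the target as the transposition of p and q.  As 1 and -1 differ modulo 3,
    the ordered pair (p, q) can still be read off from eps_p - eps_q. *)
Definition boundary (y : V) (t : P) : 'F_3 :=
  \sum_k (y k)%:~R * ((k.1 == t)%:R - (k.2 == t)%:R).

Lemma boundary_simple k t : boundary (e k) t = (k.1 == t)%:R - (k.2 == t)%:R.
Proof.
rewrite /boundary (bigD1 k) //= ffunE eqxx mul1r big1 ?addr0 // => j /negPf jk.
by rewrite ffunE jk mul0r.
Qed.

Lemma boundary_refl k y t : k.1 != k.2 ->
  boundary (refl B k y) t = boundary y (tperm k.1 k.2 t).
Proof.
move=> k12.
have pE : (pairing B y k)%:~R = boundary y k.1 - boundary y k.2 :> 'F_3.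
  rewrite /pairing rmorph_sum -sumrB; apply: eq_bigr => j _.
  by rewrite rmorphM /= pair_form_mod3 // -mulrBr.
have -> : boundary (refl B k y) t = boundary y t
    - (pairing B y k)%:~R * ((k.1 == t)%:R - (k.2 == t)%:R).
  rewrite -boundary_simple {1 3}/boundary mulr_sumr -sumrB.
  apply: eq_bigr => j _.
  by rewrite !ffunE !(rmorphB, rmorphM) /= rmorph_nat; ring.
rewrite pE; case: tpermP => [->|->|/eqP tk1 /eqP tk2].
- rewrite eqxx [k.2 == _]eq_sym (negPf k12) /=; ring.
- by rewrite eqxx (negPf k12) /=; ring.
- by rewrite ![_ == t]eq_sym (negPf tk1) (negPf tk2) /=; ring.
Qed.

Definition permv (s : {perm P}) (y : V) : V := [ffun k => y (s k.1, s k.2)].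

Definition permp (s : {perm P}) k := (s k.1, s k.2).

Lemma permp_inj s : injective (permp s).
Proof. by move=> [a b] [c d] [/perm_inj -> /perm_inj ->]. Qed.

Lemma permpKV s : cancel (permp s^-1) (permp s).
Proof. by case=> a b; rewrite /permp /= !permKV. Qed.

Lemma pair_form_permp s k l : B (permp s k) (permp s l) = B k l.
Proof.
by rewrite /B (inj_eq (@permp_inj s)) /dipole_form /= !(inj_eq perm_inj).
Qed.

Lemma permv_simple s k : permv s (e (permp s k)) = e k.
Proof.
apply/ffunP => l.
by rewrite !ffunE -[(_, _)]/(permp s l) (inj_eq (@permp_inj s)).
Qed.

Lemma permv_refl s k y :
  permv s (refl B (permp s k) y) = refl B k (permv s y).
Proof.
apply/ffunP => l; rewrite !ffunE -![(s _, s _)]/(permp s _).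
rewrite (inj_eq (@permp_inj s)); congr (_ - _ * _).
rewrite /pairing (reindex_inj (@permp_inj s)) /=; apply: eq_bigr => j _.
by rewrite ffunE pair_form_permp.
Qed.

Lemma permvM s t y : permv s (permv t y) = permv (s * t)%g y.
Proof. by apply/ffunP => k; rewrite !ffunE !permM. Qed.

Lemma permv1 y : permv 1%g y = y.
Proof. by apply/ffunP => -[a b]; rewrite !ffunE !perm1. Qed.

Lemma permv_inj s : injective (permv s).
Proof.
move=> y z yz; rewrite -[y]permv1 -[z]permv1 -(mulVg s) -!permvM.
by rewrite yz.
Qed.

Lemma permv_root s y : real_root B y -> real_root B (permv s y).
Proof.
elim=> [k|k {}y _ IHy]; rewrite -(permpKV s k).
  by rewrite permv_simple; apply: real_root_simple.
by rewrite permv_refl; apply: real_root_refl.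
Qed.

Lemma boundary_permv s y t : boundary (permv s y) t = boundary y (s t).
Proof.
rewrite /boundary [RHS](reindex_inj (@permp_inj s)) /=; apply: eq_bigr => j _.
by rewrite ffunE !(inj_eq perm_inj).
Qed.

Lemma dipole_inj (a b p q : P) : a != b ->
    (forall t, (a == t)%:R - (b == t)%:R = (p == t)%:R - (q == t)%:R :> 'F_3) ->
  a = p /\ b = q.
Proof.
move=> ab E; split.
  have := E a; rewrite eqxx [b == a]eq_sym (negPf ab) [p == a]eq_sym.
  by case: (@eqP P a p) => // _ /eqP; case: (@eqP P q a) => _.
have := E b; rewrite eqxx (negPf ab) [q == b]eq_sym.
by case: (@eqP P b q) => // _ /eqP; case: (@eqP P p b) => _.
Qed.

End PairForm.

(** * The retraction on words *)

Section Retraction.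

Local Open Scope ring_scope.

Variable m : nat.

Local Notation P := 'I_m.+1.
Local Notation e := (@simple_root (P * P)%type).
Local Notation refl := (refl (@pair_form P)).

(** Let W be the Coxeter group of [pair_form] and X its set of generators
    (a, a + 1).  A coset of the parabolic subgroup W_X, with shortest
    representative w, is recorded by the inverse images under w of the simple
    roots of X. *)
Definition state := {ffun 'I_m -> {ffun P * P -> int}}.

Implicit Types (S : state) (k l : P * P) (g h : 'I_m -> sgen m).

Definition lpos (i : 'I_m) : P := widen_ord (leqnSn m) i.
Definition rpos (i : 'I_m) : P := lift ord0 i.
Definition pos (i : 'I_m) : P * P := (lpos i, rpos i).

Definition srefl k S : state := [ffun a => refl k (S a)].
Definition sperm (s : {perm P}) S : state := [ffun a => permv s (S a)].

(** A crossing at the pair k is kept, under the label a, when w conjugates the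
    reflection k to the generator a of X, and then the coset does not change;
    otherwise the crossing is erased and the coset is multiplied by k.  The
    kind of letter, positive, negative or singular, is the parameter g. *)
Definition cross g k S : state * seq (sgen m) :=
  if [pick a | S a == e k] is Some a then (S, [:: g a]) else (srefl k S, [::]).

Definition step S (x : svgen m) : state * seq (sgen m) :=
  match x with
  | SVSig i => cross (@SSig m) (pos i) S
  | SVSigV i => cross (@SSigV m) (pos i) S
  | SVTau i => cross (@STau m) (pos i) S
  | SVRho i => (sperm (tperm (lpos i) (rpos i)) S, [::])
  end.

Fixpoint run S (w : seq (svgen m)) : state * seq (sgen m) :=
  if w is x :: w' then
    let c := step S x in ((run c.1 w').1, c.2 ++ (run c.1 w').2)
  else (S, [::]).

(** An invariant of the states met by [run].  Nonnegativity says that the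
    representative w of the coset is the shortest one.  The last condition
    places the braid positions injectively among the virtual positions, so that
    the root of label a goes from the image of a to that of a + 1: if crossings
    at (p, q) and (q, r) are kept, their labels are then a and a + 1, and if
    crossings at disjoint pairs are kept, their labels are far apart. *)
Definition valid S : Prop :=
  [/\ forall a, real_root (@pair_form P) (S a), forall a, nonneg (S a)
    & exists2 f : P -> P, injective f & forall a t,
        boundary (S a) t = (f (lpos a) == t)%:R - (f (rpos a) == t)%:R].

Definition same_run (c c' : state * seq (sgen m)) : Prop :=
  c.1 = c'.1 /\ wcong (@SB_rel m) c.2 c'.2.

Lemma lpos_inj : injective lpos.
Proof. by move=> i j /(congr1 val) /= /val_inj. Qed.

Lemma rpos_inj : injective rpos.
Proof. exact: lift_inj. Qed.

Lemma lpos_rpos i : lpos i != rpos i.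
Proof. by rewrite -val_eqE /= /bump /= add1n neq_ltn leqnn. Qed.

Lemma far_pos (i j : 'I_m) : far i j ->
  [/\ lpos i != lpos j, lpos i != rpos j, rpos i != lpos j & rpos i != rpos j].
Proof.
rewrite /far -!val_eqE /= /bump /= !add1n.
by move=> ij; split; apply/eqP => E; move: ij; rewrite ?E; lia.
Qed.

Lemma disjoint_far (i j : 'I_m) :
  lpos i != lpos j -> lpos i != rpos j -> rpos i != lpos j -> far i j.
Proof.
rewrite /far -!val_eqE /= /bump /= !add1n; lia.
Qed.

Lemma adj_pos (i j : 'I_m) : adj i j = (rpos i == lpos j).
Proof. by rewrite /adj -val_eqE /= /bump /= add1n eq_sym. Qed.

Lemma adj_lpos_rpos (i j : 'I_m) : adj i j -> lpos i != rpos j.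
Proof. by rewrite /adj -val_eqE /= /bump /= !add1n; lia. Qed.

(** No other root of the state can be equal to the simple root k, because the
    boundaries of the roots are distinct. *)
Lemma cross_hit g k S a : valid S -> S a = e k -> cross g k S = (S, [:: g a]).
Proof.
case=> _ _ [f f_inj fE] Sa; rewrite /cross; case: pickP => [b /eqP Sb|/(_ a)].
  congr (_, [:: g _]); apply: lpos_inj; apply: (f_inj).
  suff [-> //] : f (lpos b) = f (lpos a) /\ f (rpos b) = f (rpos a).
  apply: dipole_inj => [|t]; first by rewrite (inj_eq f_inj) lpos_rpos.
  by rewrite -!fE Sa Sb.
by rewrite Sa eqxx.
Qed.

Lemma cross_miss g k S :
  (forall a, S a <> e k) -> cross g k S = (srefl k S, [::]).
Proof. by move=> miss; rewrite /cross; case: pickP => [b /eqP /miss|]. Qed.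

Lemma hit_or_miss y S : (exists a, S a = y) \/ (forall a, S a <> y).
Proof.
case: (pickP (fun a => S a == y)) => [a /eqP|no]; first by left; exists a.
by right=> a Sa; have := no a; rewrite Sa eqxx.
Qed.

Lemma valid_ends S : valid S -> exists2 f : P -> P, injective f &
  forall a p q y, p != q ->
    (forall t, boundary y t = (p == t)%:R - (q == t)%:R) ->
    S a = y -> f (lpos a) = p /\ f (rpos a) = q.
Proof.
case=> _ _ [f f_inj fE]; exists f => // a p q y pq yE Sa.
apply: dipole_inj => [|t]; first by rewrite (inj_eq f_inj) lpos_rpos.
by rewrite -fE Sa yE.
Qed.

Lemma valid_srefl k S :
  k.1 != k.2 -> valid S -> (forall a, S a <> e k) -> valid (srefl k S).
Proof.
move=> k12 [rootS posS [f f_inj fE]] miss; split=> [a|a|].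
- by rewrite ffunE; apply: real_root_refl.
- rewrite ffunE; apply: refl_nonneg => //; last exact/eqP.
  + exact: pair_form_diag.
  + exact: pair_form_sym.
  + exact: pair_form_off.
- exists (tperm k.1 k.2 \o f) => [|a t]; first exact: inj_comp perm_inj f_inj.
  rewrite ffunE boundary_refl // fE /= -!(can2_eq (tpermK _ _) (tpermK _ _)).
  by [].
Qed.

Lemma valid_sperm s S : valid S -> valid (sperm s S).
Proof.
move=> [rootS posS [f f_inj fE]]; split=> [a|a k|].
- by rewrite ffunE; apply: permv_root.
- by rewrite !ffunE; apply: posS.
- exists (s^-1%g \o f) => [|a t]; first exact: inj_comp perm_inj f_inj.
  by rewrite ffunE boundary_permv fE /= !(can2_eq (permKV s) (permK s)).
Qed.

Lemma valid_cross g k S : k.1 != k.2 -> valid S -> valid (cross g k S).1.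
Proof.
move=> k12 vS; have [[a Sa]|miss] := hit_or_miss (e k) S.
  by rewrite (cross_hit _ vS Sa).
by rewrite (cross_miss _ miss); apply: valid_srefl.
Qed.

Lemma sreflK k : involutive (srefl k).
Proof.
by move=> S; apply/ffunP => a; rewrite !ffunE reflK //; apply: pair_form_diag.
Qed.

Lemma srefl_hit k S a y : srefl k S a = y -> S a = refl k y.
Proof. by move <-; rewrite ffunE reflK //; apply: pair_form_diag. Qed.

(** The negative of a simple root never occurs in a valid state: after an erased
    crossing, a second crossing at the same place is erased as well. *)
Lemma miss_reflected k S : valid S -> forall a, srefl k S a <> e k.
Proof.
case=> _ posS _ a /srefl_hit Sa; have := posS a k.
by rewrite Sa refl_simple ?ffunE ?eqxx //; apply: pair_form_diag.
Qed.

Lemma refl_orth k l : pair_form k l = 0 -> refl k (e l) = e l.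
Proof.
move=> kl; apply/ffunP => j; rewrite ffunE pairing_simple pair_form_sym kl.
by rewrite mulr0 subr0.
Qed.

Definition cross2 g h k l S :=
  let c1 := cross g k S in let c2 := cross h l c1.1 in (c2.1, c1.2 ++ c2.2).

(** The reflection at one of two disjoint pairs fixes the simple root of the
    other, so it does not affect whether the other crossing is kept. *)
Lemma cross_comm g h k l S :
    k.1 != k.2 -> l.1 != l.2 ->
    k.1 != l.1 -> k.1 != l.2 -> k.2 != l.1 -> k.2 != l.2 ->
    (forall a b, far a b -> wcong (@SB_rel m) [:: g a; h b] [:: h b; g a]) ->
    valid S ->
  same_run (cross2 g h k l S) (cross2 h g l k S).
Proof.
rewrite /cross2 => k12 l12 d11 d12 d21 d22 ghC vS.
have kl : pair_form k l = 0 by apply: pair_form_disjoint.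
have lk : pair_form l k = 0 by rewrite pair_form_sym.
have [f f_inj ends] := valid_ends vS.
have [[a Sa]|missk] := hit_or_miss (e k) S;
  have [[b Sb]|missl] := hit_or_miss (e l) S.
- rewrite !(cross_hit _ vS Sa, cross_hit _ vS Sb) /=; split=> //.
  have [fla fra] := ends _ _ _ _ k12 (boundary_simple _) Sa.
  have [flb frb] := ends _ _ _ _ l12 (boundary_simple _) Sb.
  apply: ghC; apply: disjoint_far;
    by rewrite -(inj_eq f_inj) ?fla ?fra ?flb ?frb.
- rewrite (cross_hit _ vS Sa) (cross_miss _ missl) /=.
  have S'a : srefl l S a = e k by rewrite ffunE Sa refl_orth.
  rewrite (cross_hit _ (valid_srefl l12 vS missl) S'a) /=.
  by split=> //; apply: wcong_refl.
- rewrite (cross_hit _ vS Sb) (cross_miss _ missk) /=.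
  have S'b : srefl k S b = e l by rewrite ffunE Sb refl_orth.
  rewrite (cross_hit _ (valid_srefl k12 vS missk) S'b) /=.
  by split=> //; apply: wcong_refl.
- rewrite (cross_miss _ missk) (cross_miss _ missl) /=.
  rewrite !cross_miss /=; last 2 first.
  + by move=> a /srefl_hit; rewrite refl_orth //; apply: missk.
  + by move=> a /srefl_hit; rewrite refl_orth //; apply: missl.
  split; last exact: wcong_refl.
  by apply/ffunP => a; rewrite !ffunE refl_comm //; apply: pair_form_sym.
Qed.

Definition cross3 g1 g2 g3 k l S :=
  let c1 := cross g1 k S in let c2 := cross g2 l c1.1 in
  let c3 := cross g3 k c2.1 in (c3.1, c1.2 ++ c2.2 ++ c3.2).

(** The three successive crossings involve the roots e_k, e_k + e_l and e_l, met
    in the opposite order on the other side.  Boundaries show that a state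
    containing one of e_k, e_l cannot contain the sum, so the kept crossings
    are all three, a single one, or none; in the first case the
    labels are consecutive in the right order, again by boundaries.  The kinds
    of the letters are arbitrary, which covers at once the braid relation and
    the relation sigma sigma tau = tau sigma sigma. *)
Lemma cross_braid g1 g2 g3 p q r S :
    p != q -> q != r -> p != r ->
    (forall a b, adj a b ->
       wcong (@SB_rel m) [:: g1 a; g2 b; g3 a] [:: g3 b; g2 a; g1 b]) ->
    valid S ->
  same_run (cross3 g1 g2 g3 (p, q) (q, r) S) (cross3 g3 g2 g1 (q, r) (p, q) S).
Proof.
move=> pq qr pr gB vS; set k := (p, q); set l := (q, r).
have k12 : k.1 != k.2 by []. have l12 : l.1 != l.2 by [].
have kl : pair_form k l = -1 by apply: pair_form_path.
have lk : pair_form l k = -1 by rewrite pair_form_sym.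
have diag := @pair_form_diag P; have sym := @pair_form_sym P.
have vE : refl l (e k) = refl k (e l).
  by apply/ffunP => j; rewrite !ffunE !pairing_simple kl lk; ring.
have vkl : refl l (refl k (e l)) = e k by rewrite -vE reflK.
have vlk : refl k (refl l (e k)) = e l by rewrite vE reflK.
have vB t : boundary (refl k (e l)) t = (p == t)%:R - (r == t)%:R.
  rewrite boundary_refl // boundary_simple /=.
  rewrite -!(can2_eq (tpermK p q) (tpermK p q)).
  by rewrite tpermR tpermD // eq_sym.
have [f f_inj ends] := valid_ends vS.
have endsk a := ends a _ _ _ pq (boundary_simple k).
have endsl a := ends a _ _ _ qr (boundary_simple l).
have endsv a := ends a _ _ _ pr vB.
have [[a Sa]|missk] := hit_or_miss (e k) S;
  have [[b Sb]|missl] := hit_or_miss (e l) S.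
- rewrite /cross3 !(cross_hit _ vS Sa, cross_hit _ vS Sb) /=; split=> //.
  apply: gB; rewrite adj_pos -(inj_eq f_inj).
  by have [_ ->] := endsk _ Sa; have [-> _] := endsl _ Sb.
- have vS1 := valid_srefl l12 vS missl.
  have miss1 b : srefl l S b <> e k.
    move/srefl_hit; rewrite vE => Sb.
    have [pE rE] := endsv _ Sb; have [pE' qE] := endsk _ Sa.
    have ab : a = b by apply: lpos_inj; apply: f_inj; rewrite pE.
    by move/eqP: qr; apply; rewrite -rE -ab.
  have vS2 := valid_srefl k12 vS1 miss1.
  have S2a : srefl k (srefl l S) a = e l by rewrite !ffunE Sa.
  rewrite /cross3 (cross_hit _ vS Sa) !(cross_miss _ missl) /=.
  rewrite !(cross_miss _ miss1) /=.
  by rewrite (cross_hit _ vS2 S2a); split=> //; apply: wcong_refl.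
- have vS1 := valid_srefl k12 vS missk.
  have miss1 c : srefl k S c <> e l.
    move/srefl_hit => Sc.
    have [pE rE] := endsv _ Sc; have [qE rE'] := endsl _ Sb.
    have bc : b = c by apply: rpos_inj; apply: f_inj; rewrite rE.
    by move/eqP: pq; apply; rewrite -pE -bc.
  have vS2 := valid_srefl l12 vS1 miss1.
  have S2b : srefl l (srefl k S) b = e k by rewrite !ffunE Sb.
  rewrite /cross3 (cross_hit _ vS Sb) !(cross_miss _ missk) /=.
  rewrite !(cross_miss _ miss1) /=.
  by rewrite (cross_hit _ vS2 S2b); split=> //; apply: wcong_refl.
- have vSk := valid_srefl k12 vS missk; have vSl := valid_srefl l12 vS missl.
  rewrite /cross3 !(cross_miss _ missk) !(cross_miss _ missl) /=.
  have [[c Sc]|missv] := hit_or_miss (refl k (e l)) S.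
    have Skc : srefl k S c = e l by rewrite ffunE Sc reflK.
    have Slc : srefl l S c = e k by rewrite ffunE Sc.
    rewrite !(cross_hit _ vSk Skc) !(cross_hit _ vSl Slc) /=.
    rewrite !(cross_miss _ (miss_reflected vS)) !sreflK /=.
    by split=> //; apply: wcong_refl.
  have miss1 a : srefl k S a <> e l by move/srefl_hit; apply: missv.
  have miss1' a : srefl l S a <> e k.
    by move/srefl_hit; rewrite vE; apply: missv.
  have miss2 a : srefl l (srefl k S) a <> e k.
    by move/srefl_hit/srefl_hit; rewrite vlk; apply: missl.
  have miss2' a : srefl k (srefl l S) a <> e l.
    by move/srefl_hit/srefl_hit; rewrite vkl; apply: missk.
  rewrite !(cross_miss _ miss1) !(cross_miss _ miss1') /=.
  rewrite !(cross_miss _ miss2) !(cross_miss _ miss2') /=.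
  split; last exact: wcong_refl.
  by apply/ffunP => a; rewrite !ffunE refl_braid.
Qed.

Lemma cross_perm g k s S :
  cross g k (sperm s S) =
    (sperm s (cross g (permp s k) S).1, (cross g (permp s k) S).2).
Proof.
have E a : (sperm s S a == e k) = (S a == e (permp s k)).
  by rewrite ffunE -(permv_simple s) (inj_eq (@permv_inj _ s)).
rewrite /cross (eq_pick E); case: pickP => //= _; congr (_, _).
by apply/ffunP => a; rewrite !ffunE -permv_refl.
Qed.

Lemma sperm_comp s t S : sperm s (sperm t S) = sperm (s * t)%g S.
Proof. by apply/ffunP => a; rewrite !ffunE permvM. Qed.

Lemma valid_step S x : valid S -> valid (step S x).1.
Proof.
by case: x => i vS /=; [| | exact: valid_sperm |];
  apply: valid_cross => //; apply: lpos_rpos.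
Qed.

Lemma valid_run S w : valid S -> valid (run S w).1.
Proof. by elim: w S => //= x w IHw S vS; apply/IHw/valid_step. Qed.

Lemma run_cat S u v :
  run S (u ++ v) =
    ((run (run S u).1 v).1, (run S u).2 ++ (run (run S u).1 v).2).
Proof.
elim: u S => [|x u IHu] S; first by case: (run S v).
by rewrite cat_cons /= IHu /= catA.
Qed.

Lemma cross_perm_far g (s : {perm P}) k S : s k.1 = k.1 -> s k.2 = k.2 ->
  cross g k (sperm s S) = (sperm s (cross g k S).1, (cross g k S).2).
Proof. by case: k => p q /= ps qs; rewrite cross_perm /permp /= ps qs. Qed.

Lemma tperm_far (i j : 'I_m) : far i j ->
  tperm (lpos i) (rpos i) (lpos j) = lpos j /\
  tperm (lpos i) (rpos i) (rpos j) = rpos j.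
Proof. by case/far_pos=> *; rewrite !tpermD. Qed.

Lemma far_sym (i j : 'I_m) : far i j = far j i.
Proof. by rewrite /far orbC. Qed.

Lemma cross_pos_comm g h i j S : far i j ->
    (forall a b, far a b -> wcong (@SB_rel m) [:: g a; h b] [:: h b; g a]) ->
    valid S ->
  same_run (cross2 g h (pos i) (pos j) S) (cross2 h g (pos j) (pos i) S).
Proof.
move=> /far_pos[ll lr rl rr] ghC vS.
by apply: cross_comm => //=; rewrite ?lpos_rpos // eq_sym.
Qed.

Lemma cross_pos_braid g1 g2 g3 i j S : adj i j ->
    (forall a b, adj a b ->
       wcong (@SB_rel m) [:: g1 a; g2 b; g3 a] [:: g3 b; g2 a; g1 b]) ->
    valid S ->
  same_run (cross3 g1 g2 g3 (pos i) (pos j) S)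
           (cross3 g3 g2 g1 (pos j) (pos i) S).
Proof.
move=> /[dup] /adj_lpos_rpos lr; rewrite adj_pos => /eqP ij gB vS.
rewrite /pos -ij; apply: cross_braid => //; first exact: lpos_rpos.
by rewrite ij lpos_rpos.
Qed.

Lemma cross_cancel g h k S : k.1 != k.2 ->
    (forall a, wcong (@SB_rel m) [:: g a; h a] [::]) -> valid S ->
  same_run (cross2 g h k k S) (S, [::]).
Proof.
move=> k12 ghV vS; rewrite /cross2.
have [[a Sa]|miss] := hit_or_miss (e k) S.
  by rewrite !(cross_hit _ vS Sa); split=> //=; apply: ghV.
rewrite !(cross_miss _ miss) /= !(cross_miss _ (miss_reflected vS)) /= sreflK.
by split=> //; apply: wcong_refl.
Qed.

Lemma cross_same g h k S : k.1 != k.2 ->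
    (forall a, wcong (@SB_rel m) [:: g a; h a] [:: h a; g a]) -> valid S ->
  same_run (cross2 g h k k S) (cross2 h g k k S).
Proof.
move=> k12 ghC vS; rewrite /cross2.
have [[a Sa]|miss] := hit_or_miss (e k) S.
  by rewrite !(cross_hit _ vS Sa); split=> //=; apply: ghC.
rewrite !(cross_miss _ miss) /= !(cross_miss _ (miss_reflected vS)) /= sreflK.
by split=> //; apply: wcong_refl.
Qed.

Lemma adj_tperm (i j : 'I_m) : adj i j ->
  let s := tperm (lpos i) (rpos i) in let t := tperm (lpos j) (rpos j) in
  [/\ permp s (pos j) = (lpos i, rpos j), permp t (pos i) = (lpos i, rpos j)
    & (s * t * s = t * s * t)%g].
Proof.
move=> /[dup] /adj_lpos_rpos n3; rewrite adj_pos => /eqP ij s t.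
have n1 := lpos_rpos i; have n2 := lpos_rpos j.
have sj : permp s (pos j) = (lpos i, rpos j).
  by rewrite /permp /= -ij tpermR tpermD // ij.
have ti : permp t (pos i) = (lpos i, rpos j).
  by rewrite /permp /= ij tpermL tpermD // eq_sym // -ij.
split=> //; rewrite -!mulgA.
have -> : (s * (t * s) = t ^ s)%g by rewrite conjgE tpermV.
have -> : (t * (s * t) = s ^ t)%g by rewrite conjgE tpermV.
by rewrite !tpermJ; case: sj => -> ->; case: ti => -> ->.
Qed.

(** On both sides, the crossing takes place at the pair formed by the first and
    the third of the three consecutive positions. *)
Lemma cross_rho_slide g i j S : adj i j ->
  let s := tperm (lpos i) (rpos i) in let t := tperm (lpos j) (rpos j) in
  let c := cross g (pos j) (sperm s S) in
  let d := cross g (pos i) (sperm t S) in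
  (sperm s c.1, c.2) = (sperm t d.1, d.2).
Proof.
move=> ij s t; have [sj ti _] := adj_tperm ij.
by rewrite /= !cross_perm sj ti /= !sperm_comp !tperm2.
Qed.

Lemma sperm1 S : sperm 1%g S = S.
Proof. by apply/ffunP => a; rewrite ffunE permv1. Qed.

Lemma same_run_refl c : same_run c c.
Proof. by split=> //; apply: wcong_refl. Qed.

Lemma run2 S x y : run S [:: x; y] =
  let c1 := step S x in let c2 := step c1.1 y in (c2.1, c1.2 ++ c2.2).
Proof. by rewrite /= cats0. Qed.

Lemma run3 S x y z : run S [:: x; y; z] =
  let c1 := step S x in let c2 := step c1.1 y in let c3 := step c2.1 z in
  (c3.1, c1.2 ++ c2.2 ++ c3.2).
Proof. by rewrite /= cats0. Qed.

Lemma run_rel S u v : valid S -> SVB_rel u v -> same_run (run S u) (run S v).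
Proof.
move=> vS [] => [i j ij|i|i|i j ij|i j ij|i j ij|i|i j ij|i j ij|i j ij|i
  |i j ij|i j ij|i j ij|i j ij]; rewrite ?run3 ?run2.
- apply: cross_pos_comm => // a b ab; apply: wcong_rel; exact: SB_R0.
- apply: (@cross_cancel _ _ (pos i) _ (lpos_rpos i) _ vS) => a.
  by apply: wcong_rel; apply: SB_R2r.
- apply: (@cross_cancel _ _ (pos i) _ (lpos_rpos i) _ vS) => a.
  by apply: wcong_rel; apply: SB_R2l.
- apply: cross_pos_braid => // a b ab; apply: wcong_rel; exact: SB_R3.
- apply: cross_pos_comm => // a b ab; apply: wcong_rel; exact: SB_S1.
- apply: cross_pos_comm => // a b ab; apply: wcong_rel; exact: SB_S2.
- apply: (@cross_same _ _ (pos i) _ (lpos_rpos i) _ vS) => a.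
  by apply: wcong_rel; apply: SB_S3.
- apply: cross_pos_braid => // a b ab; apply: wcong_rel; exact: SB_S4.
- have [l r] := tperm_far ij; rewrite /= !sperm_comp.
  have -> : (tperm (lpos i) (rpos i) * tperm (lpos j) (rpos j)
             = tperm (lpos j) (rpos j) * tperm (lpos i) (rpos i))%g.
    by rewrite [RHS]conjgC tpermJ l r.
  exact: same_run_refl.
- have [l r] := tperm_far (etrans (far_sym _ _) ij).
  by rewrite /= ?cats0 cross_perm_far //; apply: same_run_refl.
- by rewrite /= sperm_comp tperm2 sperm1; apply: same_run_refl.
- rewrite /= !sperm_comp; have [_ _ ->] := adj_tperm ij.
  exact: same_run_refl.
- by rewrite /= !cats0 cross_rho_slide //; apply: same_run_refl.
- have [l r] := tperm_far ij.
  by rewrite /= ?cats0 cross_perm_far //; apply: same_run_refl.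
- by rewrite /= !cats0 cross_rho_slide //; apply: same_run_refl.
Qed.

Lemma run_wcong S u v :
  valid S -> wcong (@SVB_rel m) u v -> same_run (run S u) (run S v).
Proof.
move=> vS uv; elim: uv S vS => {u v}.
- by move=> u v uv S vS; apply: run_rel.
- by move=> u S _; apply: same_run_refl.
- by move=> u v _ IH S /IH[uv1 uv2]; split; [| apply: wcong_sym].
- move=> u v w _ IHuv _ IHvw S vS.
  have [uv1 uv2] := IHuv S vS; have [vw1 vw2] := IHvw S vS.
  by split; [rewrite uv1 | apply: wcong_trans vw2].
- move=> u u' v v' _ IHu _ IHv S vS; rewrite !run_cat.
  have [u1 u2] := IHu S vS; rewrite -u1.
  have [v1 v2] := IHv _ (valid_run u vS).
  by split=> //=; apply: wcong_cat.
Qed.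

Definition state0 : state := [ffun a => e (pos a)].

Lemma valid_state0 : valid state0.
Proof.
split=> [a|a k|]; first by rewrite ffunE; apply: real_root_simple.
  by rewrite !ffunE; case: eqP.
by exists id => // a t; rewrite ffunE boundary_simple.
Qed.

Definition sv_of_s (x : sgen m) : svgen m :=
  match x with SSig i => SVSig i | SSigV i => SVSigV i | STau i => SVTau i end.

(** From the trivial coset, every letter of a singular braid word is kept. *)
Lemma run_state0 u : run state0 (map sv_of_s u) = (state0, u).
Proof.
have hit i : state0 i = e (pos i) by rewrite ffunE.
have hits g i := cross_hit g valid_state0 (hit i).
by elim: u => [//|[i|i|i] u IHu] /=; rewrite hits /= IHu.
Qed.

End Retraction.

(** * Injectivity *)

Section Presentations.

Local Open Scope group_scope.

Lemma pcls2 (X : choiceType) R (a b : X) :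
  pcls R [:: a] * pcls R [:: b] = pcls R [:: a; b].
Proof. exact: pclsM. Qed.

Lemma pcls3 (X : choiceType) R (a b c : X) :
  pcls R [:: a] * (pcls R [:: b] * pcls R [:: c]) = pcls R [:: a; b; c].
Proof. by rewrite [X in _ * X]pclsM pclsM. Qed.

Lemma pmon_morph_ext (X : choiceType) (R : seq X -> seq X -> Prop)
    (M : monoidType) (f g : pmon R -> M) :
    monoid.monoid_morphism f -> monoid.monoid_morphism g ->
    (forall x, f (pcls R [:: x]) = g (pcls R [:: x])) ->
  f =1 g.
Proof.
move=> [f1 fM] [g1 gM] fg c; rewrite -(pclsK c).
elim: (generic_quotient.repr c) => [|x u IHu]; first by rewrite [LHS]f1 [RHS]g1.
by rewrite -[x :: u]/([:: x] ++ u) -pclsM fM gM fg IHu.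
Qed.

End Presentations.

Section Injectivity.

Local Open Scope group_scope.

Variable n : nat.

(** Erasing the singular generators is compatible with all relations, which
    gives retractions of SB onto B and of SVB onto VB. *)
Definition SB_B_gen (x : sgen n.-1) : B n :=
  match x with
  | SSig i => B_sigma i | SSigV i => (B_sigma i)^-1 | STau i => 1
  end.

Definition SVB_VB_gen (x : svgen n.-1) : VB n :=
  match x with
  | SVSig i => VB_sigma i | SVSigV i => (VB_sigma i)^-1
  | SVRho i => VB_rho i | SVTau i => 1
  end.

Lemma SB_B_respects : respects (@SB_rel n.-1) SB_B_gen.
Proof.
move=> _ _ [i j ij|i|i|i j ij|i j ij|i j ij|i|i j ij];
  rewrite ?(big_cons, big_nil) /= ?(mulg1, mul1g, mulgV, mulVg) //.
- by rewrite [LHS]pcls2 [RHS]pcls2; apply/pclsP/wcong_rel/grel_rel/B_R0.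
- by rewrite [LHS]pcls3 [RHS]pcls3; apply/pclsP/wcong_rel/grel_rel/B_R3.
Qed.

Lemma VB_rho2 i : VB_rho i * VB_rho i = 1 :> VB n.
Proof. by rewrite [LHS]pcls2; apply/pclsP/wcong_rel/grel_rel/VB_V3. Qed.

Lemma SVB_VB_respects : respects (@SVB_rel n.-1) SVB_VB_gen.
Proof.
move=> _ _ []; move=> *; rewrite ?(big_cons, big_nil) /=
  ?(mulg1, mul1g, mulgV, mulVg, VB_rho2) //.
all: rewrite ?[LHS]pcls3 ?[RHS]pcls3 ?[LHS]pcls2 ?[RHS]pcls2.
all: apply/pclsP/wcong_rel/grel_rel.
all: by first [exact: VB_R0 | exact: VB_R3 | exact: VB_V1 | exact: VB_V2
  | exact: VB_V4 | exact: VB_V5].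
Qed.

Lemma B_SB_inj : injective (B_SB n).
Proof.
apply: (can_inj (g := plift SB_B_respects)).
apply: pmon_morph_ext => [|//|[i []]].
- by split=> [|x y]; rewrite !(gmulf1, gmulfM).
- by rewrite -pgrp_invE B_SB_sigmaV [LHS]plift_gen.
- by rewrite [in LHS]B_SB_sigma [LHS]plift_gen.
Qed.

Lemma VB_SVB_inj : injective (VB_SVB n).
Proof.
apply: (can_inj (g := plift SVB_VB_respects)).
apply: pmon_morph_ext => [|//|[[i|i] []]].
- by split=> [|x y]; rewrite !(gmulf1, gmulfM).
- by rewrite -pgrp_invE VB_SVB_sigmaV [LHS]plift_gen.
- by rewrite [in LHS]VB_SVB_sigma [LHS]plift_gen.
- rewrite [VB_SVB n _]plift_gen [LHS]plift_gen /= -pgrp_invE.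
  by apply: esym; apply: mulg1_eq; apply: VB_rho2.
- by rewrite [in LHS]VB_SVB_rho [LHS]plift_gen.
Qed.

Lemma square_commutes : VB_SVB n \o B_VB n =1 SB_SVB n \o B_SB n.
Proof.
apply: pmon_morph_ext => [||[i []]] /=.
- by split=> [|x y] /=; rewrite !(gmulf1, gmulfM).
- by split=> [|x y] /=; rewrite !(gmulf1, gmulfM).
- rewrite [B_VB n _]plift_gen [B_SB n _]plift_gen /= /B_VB_gen /B_SB_gen /=.
  by rewrite VB_SVB_sigmaV SB_SVB_sigmaV.
- by rewrite B_VB_sigma VB_SVB_sigma B_SB_sigma SB_SVB_sigma.
Qed.

Lemma SB_SVB_pcls u : SB_SVB n (pcls _ u) = pcls _ (map (@sv_of_s _) u).
Proof.
rewrite [LHS]pliftE [RHS]pcls_prod big_map.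
by apply: eq_bigr => -[].
Qed.

(** The output of [run] from the trivial coset is a left inverse of the map from
    singular braids, at the level of words up to congruence. *)
Lemma SB_SVB_inj : injective (SB_SVB n).
Proof.
move=> x y; rewrite -(pclsK x) -(pclsK y) !SB_SVB_pcls => /pclsP xy.
have [_] := run_wcong (@valid_state0 n.-1) xy.
by rewrite !run_state0 => /pclsP.
Qed.

(** By the square, the map is the first factor of an injective composite. *)
Lemma B_VB_inj : injective (B_VB n).
Proof.
move=> x y xy; apply: B_SB_inj; apply: SB_SVB_inj.
by have /= := (square_commutes x, square_commutes y); rewrite xy => -[<- <-].
Qed.

End Injectivity.

Theorem proposition1 (n : nat) (hn : 2 <= n) :
  [/\ VB_SVB n \o B_VB n =1 SB_SVB n \o B_SB n,
      injective (B_VB n),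
      injective (B_SB n),
      injective (VB_SVB n) &
      injective (SB_SVB n)].
Proof.
split.
- exact: square_commutes.
- exact: B_VB_inj.
- exact: B_SB_inj.
- exact: VB_SVB_inj.
- exact: SB_SVB_inj.
Qed.
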